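(* Let $\Bbbk$ be a field and let $G$ be a finite, simple, connected, nontrivial graph with edge ideal $I(G)$. Then the LCM lattice $\mathcal{L}_{I(G)}$ is supersolvable if and only if $G$ has an edge adjacent to every other edge of $G$.
   Context: A graph is nontrivial if it has at least one edge. For a graph $G$ on vertex set $\{1,\ldots,n\}$, $I(G)=(x_ix_j\mid\{i,j\}\in E(G))\subseteq\Bbbk[x_1,\ldots,x_n]$. Two distinct edges are adjacent if they share a vertex. The LCM lattice $\mathcal{L}_I$ of a monomial ideal $I$ is the set of least common multiples of subsets of its minimal monomial generators (the lcm of the empty set is $1$), ordered by divisibility; it is a finite lattice with join lcm. A finite lattice $L$ is graded if it has an order-preserving function $\operatorname{rk}:L\to\mathbb{Z}$ with $\operatorname{rk}(\hat 0)=0$ and $\operatorname{rk}(y)=\operatorname{rk}(x)+1$ whenever $y$ covers $x$. A lattice $L$ is supersolvable if it is graded and there is a maximal chain $M$ of $L$ such that $\operatorname{rk}(x)+\operatorname{rk}(m)=\operatorname{rk}(x\wedge m)+\operatorname{rk}(x\vee m)$ for all $m\in M$ and $x\in L$. *)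

(* Defs.v *)
From HB Require Import structures.
From mathcomp Require Import all_boot all_order all_algebra.
From mathcomp Require Import boolp.
From mathcomp.multinomials Require Import mpoly.

Set Implicit Arguments.
Unset Strict Implicit.
Unset Printing Implicit Defensive.

Import Order.Theory GRing.Theory.

Local Open Scope ring_scope.

Section Supersolvable.
Context {d : Order.disp_t} {L : finTBLatticeType d}.
Implicit Types (x y : L) (M : {set L}) (rk : L -> int).
Local Open Scope order_scope.

Definition covers y x : Prop := x < y /\ forall z, ~ (x < z /\ z < y).

Definition is_rank rk : Prop :=
  [/\ forall x y, x <= y -> (rk x <= rk y)%R,
      rk \bot = 0%R
    & forall x y, covers y x -> rk y = (rk x + 1)%R].

Definition is_chain M : bool := [forall x in M, forall y in M, x >=< y].

Definition maximal_chain M : bool := maxset is_chain M.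

End Supersolvable.

(* A rank function of a finite lattice is unique (saturated chains from \bot),
   so the existential over [rk] involves no choice. *)
Definition supersolvable {d : Order.disp_t} (L : finTBLatticeType d) : Prop :=
  exists rk : L -> int, is_rank rk /\
  exists2 M : {set L}, maximal_chain M &
    forall m x : L, m \in M ->
      rk x + rk m = rk (Order.meet x m) + rk (Order.join x m).

Section Ideals.
Context {k : comNzRingType} {n : nat}.
Implicit Types (I : {mpoly k[n]} -> Prop) (S : 'X_{1..n} -> Prop).

Definition ideal_gen {R : comNzRingType} (P : R -> Prop) (p : R) : Prop :=
  exists2 r : seq (R * R), (forall u, u \in r -> P u.2) &
    p = \sum_(u <- r) u.1 * u.2.

Definition monomial_ideal S : {mpoly k[n]} -> Prop :=
  ideal_gen (fun p => exists2 m, S m & p = 'X_[m]).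

(* [(m <= m')%MM] is divisibility of monomials; the order [(m <= m')%O] that
   the library puts on ['X_{1..n}] is a total monomial order instead.
   [mingen_gen] and [mingen_least] below show that for a monomial ideal these
   monomials are its unique minimal set of monomial generators. *)
Definition mingen I : pred 'X_{1..n} := fun m =>
  `[< I 'X_[m] /\ forall m', I 'X_[m'] -> (m' <= m)%MM -> m' = m >].

Definition mlcms (s : seq 'X_{1..n}) : 'X_{1..n} := \big[@mlcm n/0%MM]_(m <- s) m.

(* Finite sequences suffice: there are finitely many minimal generators, by
   [mingen_finite] below. *)
Definition lcm_of_mingens I : pred 'X_{1..n} := fun m =>
  `[< exists2 s, all (mingen I) s & m = mlcms s >].

Record lcm_lattice I :=
  LcmLattice { lcm_mon :> 'X_{1..n}; lcm_monP : lcm_of_mingens I lcm_mon }.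

HB.instance Definition _ I := [isSub for @lcm_mon I].
HB.instance Definition _ I := [Countable of lcm_lattice I by <:].

End Ideals.

Section Mingen.
Context {k : comNzRingType} {n : nat}.
Implicit Types (I : {mpoly k[n]} -> Prop) (S : 'X_{1..n} -> Prop).

Lemma ideal_gen_sub (R : comNzRingType) (P Q : R -> Prop) p :
  (forall x, P x -> ideal_gen Q x) -> ideal_gen P p -> ideal_gen Q p.
Proof.
move=> PQ [r rP ->{p}]; elim: r rP => [|[a b] r IHr] rP.
  by exists [::] => [u|]; rewrite ?big_nil.
have [|s sQ defs] := IHr; first by move=> u ur; apply: rP; rewrite inE ur orbT.
have [|t tQ deft] := PQ b; first by apply: (rP (a, b)); rewrite inE eqxx.
exists ([seq (a * u.1, u.2) | u <- t] ++ s).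
  by move=> u; rewrite mem_cat => /orP[/mapP[v vt ->]|/sQ//]; exact: (tQ v).
rewrite big_cons big_cat -defs /= big_map deft mulr_sumr.
by congr (_ + _); apply: eq_bigr => u _; rewrite mulrA.
Qed.

Lemma monomial_idealP S m :
  monomial_ideal (k := k) S 'X_[m] -> exists2 u, S u & (u <= m)%MM.
Proof.
case=> r rS defm.
have: m \in msupp (\sum_(u <- r) u.1 * u.2) by rewrite -defm msuppX inE.
move/msupp_sum_le/flattenP => [s /mapP[v]]; rewrite mem_filter /= => vr -> mv.
have [u Su defv] := rS _ vr; exists u => //.
move: mv; rewrite defv (perm_mem (msuppMX _ _)).
by case/mapP=> m' _ ->; apply: lem_addr.
Qed.

Lemma mingen_exists I m :
  I 'X_[m] -> exists2 u, mingen I u & (u <= m)%MM.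
Proof.
have [j] := ubnP (mdeg m); elim: j m => // j IHj m ltmj Im.
have [mI|nmI] := boolP (mingen I m); first by exists m; rewrite ?lepm_refl.
have [u [Iu um neq]] : exists u, [/\ I 'X_[u], (u <= m)%MM & u <> m].
  apply: contrapT => nex; move/asboolP: nmI; apply; split=> // u Iu um.
  by apply: contrapT => neq; apply: nex; exists u.
have [|v vI vu] := IHj u _ Iu.
  rewrite -ltnS; apply: leq_trans ltmj; rewrite ltnS.
  rewrite -(submK um) mdegD -[X in (X < _)%N]add0n ltn_add2r lt0n mdeg_eq0.
  by apply/eqP => mu0; apply: neq; rewrite -[RHS](submK um) mu0 add0m.
by exists v; rewrite // (lepm_trans vu um).
Qed.

Lemma mingen_gen S p :
  monomial_ideal S p <-> monomial_ideal (k := k) (mingen (monomial_ideal (k := k) S)) p.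
Proof.
split; apply: ideal_gen_sub => _ [m Sm ->]; last by case/asboolP: Sm.
have [|u uI um] := @mingen_exists (monomial_ideal S) m.
  exists [:: (1, 'X_[m])]; last by rewrite big_seq1 mul1r.
  by move=> u; rewrite inE => /eqP-> /=; exists m.
exists [:: ('X_[m - u], 'X_[u])]; last by rewrite big_seq1 /= -mpolyXD submK.
by move=> v; rewrite inE => /eqP-> /=; exists u.
Qed.

Lemma mingen_least S m : mingen (monomial_ideal (k := k) S) m -> S m.
Proof.
case/asboolP=> /monomial_idealP[u Su um] /(_ u) <- //.
exists [:: (1, 'X_[u])]; last by rewrite big_seq1 mul1r.
by move=> v; rewrite inE => /eqP-> /=; exists u.
Qed.

End Mingen.

Section Dickson.

Lemma dickson_seq (T : eqType) (fs : seq (T -> nat)) (P : T -> Prop) :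
  exists2 s : seq T, (forall u, u \in s -> P u) &
    forall m, P m -> exists2 u, u \in s & all (fun f => f u <= f m)%N fs.
Proof.
elim: fs P => [|f fs IHfs] P.
  have [[x Px]|nP] := pselect (exists x, P x).
    exists [:: x] => [u|m _]; first by rewrite inE => /eqP->.
    by exists x; rewrite ?inE.
  by exists [::] => // m Pm; case: nP; exists m.
have [s0 s0P s0dom] := IHfs P.
pose N := \max_(u <- s0) f u.
have [s1 s1P s1dom] : exists2 s : seq T, (forall u, u \in s -> P u) &
    forall m, P m -> (f m < N)%N ->
      exists2 u, u \in s & all (fun g => g u <= g m)%N (f :: fs).
  elim: N => [|N [s sP sdom]]; first by exists [::].
  have [t tP tdom] := IHfs (fun m => P m /\ f m = N).
  exists (s ++ t) => [u|m Pm].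
    by rewrite mem_cat => /orP[/sP|/tP[]].
  rewrite ltnS leq_eqVlt => /orP[/eqP fmN|/(sdom m Pm)[u us um]].
    have [u ut um] := tdom m (conj Pm fmN).
    exists u; first by rewrite mem_cat ut orbT.
    by rewrite /= um; have [_ ->] := tP u ut; rewrite fmN leqnn.
  by exists u; rewrite // mem_cat us.
exists (s0 ++ s1) => [u|m Pm]; first by rewrite mem_cat => /orP[/s0P|/s1P].
have [ltm|leN] := ltnP (f m) N.
  by have [u us um] := s1dom m Pm ltm; exists u; rewrite // mem_cat us orbT.
have [u us um] := s0dom m Pm; exists u; first by rewrite mem_cat us.
by rewrite /= um andbT (leq_trans _ leN) // /N leq_bigmax_seq.
Qed.

Lemma mingen_finite (k : comNzRingType) n (I : {mpoly k[n]} -> Prop) :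
  exists s : seq 'X_{1..n}, mingen I =i s.
Proof.
pose fs := [seq (fun m : 'X_{1..n} => m i) | i <- enum 'I_n].
have [s sP sdom] := dickson_seq fs (fun m => mingen I m).
exists s => m; apply/idP/idP => [mI|/sP//].
have [u us um] := sdom m mI; suff <-: u = m by [].
case/asboolP: mI => _; apply; first by case/asboolP: (sP u us).
by apply/mnm_lepP => i; move/allP: um => /(_ (fun m => m i))-> //;
   apply/mapP; exists i; rewrite ?mem_enum.
Qed.

End Dickson.

Section LcmLattice.
Context {k : comNzRingType} {n : nat} (I : {mpoly k[n]} -> Prop).
Local Notation L := (lcm_lattice I).
Implicit Types (x y z : L) (m : 'X_{1..n}) (P : pred 'X_{1..n}).

Definition mingens : seq 'X_{1..n} := projT1 (cid (mingen_finite I)).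

Lemma mem_mingens : mingen I =i mingens.
Proof. exact: projT2 (cid (mingen_finite I)). Qed.

Lemma mlcms_le (s : seq 'X_{1..n}) m :
  (mlcms s <= m)%MM = all (fun u => (u <= m)%MM) s.
Proof.
rewrite /mlcms; elim: s => [|u s IHs]; last by rewrite big_cons lem_mlcm IHs.
by rewrite big_nil; apply/mnm_lepP => i; rewrite mnm0E.
Qed.

Lemma mem_mlcms (s : seq 'X_{1..n}) m : m \in s -> (m <= mlcms s)%MM.
Proof. by have := lepm_refl (mlcms s); rewrite mlcms_le => /allP; apply. Qed.

Lemma lepm_anti m m' : (m <= m')%MM -> (m' <= m)%MM -> m = m'.
Proof.
move=> /mnm_lepP le /mnm_lepP ge; apply/mnmP => i.
by apply/eqP; rewrite eqn_leq le ge.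
Qed.

Fact lcm_filter_subproof P : lcm_of_mingens I (mlcms (filter P mingens)).
Proof.
apply/asboolP; exists (filter P mingens) => //.
by apply/allP => u; rewrite mem_filter -mem_mingens => /andP[].
Qed.

Definition lcm_filter P : L := LcmLattice (lcm_filter_subproof P).

Lemma lcm_le x m :
  (x <= m)%MM = all (fun u => (u <= x)%MM ==> (u <= m)%MM) mingens.
Proof.
apply/idP/idP => [xm|]; first by apply/allP => u _; apply/implyP => /lepm_trans->.
case: x => _ /= /[dup] /asboolP[s sI ->] _ /allP h; rewrite mlcms_le.
apply/allP => u us; have uI : u \in mingens by rewrite -mem_mingens; apply: (allP sI).
by have /implyP := h u uI; apply; apply: mem_mlcms.
Qed.

Lemma lcm_filter_le P m :
  (lcm_filter P <= m)%MM = all (fun u => P u ==> (u <= m)%MM) mingens.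
Proof. by rewrite mlcms_le all_filter. Qed.

Lemma le_lcm_filter P u : u \in mingens -> P u -> (u <= lcm_filter P)%MM.
Proof. by move=> uI Pu; rewrite mem_mlcms // mem_filter Pu. Qed.

Definition lcm_leq x y : bool := (x <= y)%MM.

Fact lcm_leq_anti : antisymmetric lcm_leq.
Proof. by move=> x y /andP[xy yx]; apply: val_inj; apply: lepm_anti. Qed.

Fact lcm_leq_trans : transitive lcm_leq.
Proof. by move=> y x z; apply: lepm_trans. Qed.

Fact lcm_display : Order.disp_t. Proof. exact: Order.Disp tt tt. Qed.

HB.instance Definition _ := Order.Le_isPOrder.Build lcm_display L
  (fun x => lepm_refl x) lcm_leq_anti lcm_leq_trans.

Lemma lcm_leE x y : (x <= y)%O = (x <= y)%MM.
Proof. by []. Qed.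

Fact lcm_join_subproof x y : lcm_of_mingens I (mlcm x y).
Proof.
case: x y => x /= /asboolP[s sI ->] [y /= /asboolP[t tI ->]].
apply/asboolP; exists (s ++ t); first by rewrite all_cat sI.
apply: lepm_anti.
  by rewrite lem_mlcm !mlcms_le; apply/andP; split; apply/allP => u us;
     rewrite mem_mlcms // mem_cat us ?orbT.
rewrite mlcms_le all_cat; apply/andP; split; apply/allP => u us.
  by rewrite (lepm_trans (mem_mlcms us)) // lem_mlcml.
by rewrite (lepm_trans (mem_mlcms us)) // lem_mlcmr.
Qed.

Definition lcm_join x y : L := LcmLattice (lcm_join_subproof x y).
Definition lcm_meet x y : L :=
  lcm_filter (fun u => (u <= x)%MM && (u <= y)%MM).

Fact lcm_meetP x y z : (x <= lcm_meet y z)%O = (x <= y)%O && (x <= z)%O.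
Proof.
rewrite !lcm_leE; apply/idP/andP => [le|[xy xz]].
  have h w : (forall u, (u <= y)%MM && (u <= z)%MM -> (u <= w)%MM) ->
      (x <= w)%MM.
    move=> hw; apply: lepm_trans le _; rewrite lcm_filter_le.
    by apply/allP => u _; apply/implyP/hw.
  by split; apply: h => u /andP[].
rewrite lcm_le; apply/allP => u uI; apply/implyP => ux.
by apply: le_lcm_filter; rewrite // (lepm_trans ux xy) (lepm_trans ux xz).
Qed.

Fact lcm_joinP x y z : (lcm_join x y <= z)%O = (x <= z)%O && (y <= z)%O.
Proof. by rewrite !lcm_leE lem_mlcm. Qed.

HB.instance Definition _ :=
  Order.POrder_MeetJoin_isLattice.Build lcm_display L lcm_meetP lcm_joinP.

Lemma lcm_joinE x y : (x `|` y)%O = mlcm x y :> 'X_{1..n}.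
Proof. by []. Qed.

Fact lcm_bot_subproof : lcm_of_mingens I 0%MM.
Proof. by apply/asboolP; exists [::]; rewrite // /mlcms big_nil. Qed.

Definition lcm_bot : L := LcmLattice lcm_bot_subproof.

Fact lcm_le0x x : (lcm_bot <= x)%O.
Proof. by rewrite lcm_leE; apply/mnm_lepP => i; rewrite mnm0E. Qed.

HB.instance Definition _ := Order.hasBottom.Build lcm_display L lcm_le0x.

Lemma lcm_botE : (\bot%O : L) = 0%MM :> 'X_{1..n}.
Proof. by []. Qed.

Definition lcm_top : L := lcm_filter predT.

Fact lcm_lex1 x : (x <= lcm_top)%O.
Proof.
rewrite lcm_leE lcm_le; apply/allP => u uI; apply/implyP => _.
exact: le_lcm_filter.
Qed.

HB.instance Definition _ := Order.hasTop.Build lcm_display L lcm_lex1.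

Definition lcm_code x : {set seq_sub mingens} :=
  [set u | (val u <= x)%MM].
Definition lcm_decode (A : {set seq_sub mingens}) : L :=
  lcm_filter (fun u => [exists v in A, val v == u]).

Fact lcm_codeK : cancel lcm_code lcm_decode.
Proof.
move=> x; apply: val_inj; apply: lepm_anti.
  rewrite lcm_filter_le; apply/allP => u _; apply/implyP.
  by case/exists_inP => v; rewrite inE => vx /eqP <-.
rewrite lcm_le; apply/allP => u uI; apply/implyP => ux.
apply: le_lcm_filter => //; apply/exists_inP.
by exists (SeqSub uI); rewrite ?inE.
Qed.

HB.instance Definition _ : isFinite L := CanIsFinite lcm_codeK.

End LcmLattice.

(* A simple graph on n vertices is a symmetric irreflexive relation on 'I_n. *)
Section Graphs.
Context {n : nat} (e : rel 'I_n).

Definition edges : {set {set 'I_n}} :=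
  [set [set p.1; p.2] | p : 'I_n * 'I_n & e p.1 p.2].

Definition adjacent (a b : {set 'I_n}) : bool := (a != b) && (a :&: b != set0).

Definition connected_graph : Prop := forall i j : 'I_n, connect e i j.

Definition edge_ideal (k : fieldType) : {mpoly k[n]} -> Prop :=
  ideal_gen (fun p => exists i j, e i j /\ p = 'X_i * 'X_j).

End Graphs.

Arguments edge_ideal {n} e k _.

(* Main.v *)
(* Sending a monomial to its support identifies the LCM lattice with the vertex
   sets S such that G[S] has no isolated vertex, ordered by inclusion; joins are
   unions, and adding to S a vertex adjacent to S is a cover.

   If the lattice is supersolvable then, G being connected, every nonempty S
   satisfies rk S + (n - |S|) = rk V.  A modular maximal chain contains an atom
   ab; for an edge cd disjoint from ab, modularity gives rk {a,b,c,d} = 2, which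
   together with rk {a,b} = 1 contradicts this formula.

   Conversely, if every edge meets the edge ab, then |S| - 1 (0 if S is empty)
   is a rank function, and every S containing a and b is modular; so any maximal
   chain through the empty set and {a,b} will do. *)
Require Import Defs.
From mathcomp.multinomials Require Import mpoly.
From mathcomp Require Import all_boot all_order all_algebra.
From mathcomp Require Import boolp zify.

Set Implicit Arguments.
Unset Strict Implicit.
Unset Printing Implicit Defensive.

Import Order.Theory GRing.Theory.

(** * Exponents of an lcm, and membership in maximal chains *)

Lemma mnm_mlcm n (m1 m2 : 'X_{1..n}) i : mlcm m1 m2 i = maxn (m1 i) (m2 i).
Proof. by rewrite mnmE. Qed.

Lemma maximal_chain_mem d (L : finTBLatticeType d) (M : {set L}) x :
  maximal_chain M -> {in M, forall y, (x >=< y)%O} -> x \in M.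
Proof.
case/maxsetP=> /forall_inP Mchain Mmax xM.
rewrite -(Mmax (x |: M)) ?setU11 ?subsetUr //.
apply/forall_inP => y; rewrite in_setU1 => /orP[/eqP->|yM]; apply/forall_inP => z;
  rewrite in_setU1 => /orP[/eqP->|zM].
- by rewrite comparablexx.
- exact: xM.
- by rewrite comparable_sym xM.
- by have /forall_inP := Mchain y yM; apply.
Qed.

(** * Supports: the LCM lattice as a lattice of vertex sets *)

Section Support.
Context {k : fieldType} {n : nat} {e : rel 'I_n}.
Hypotheses (e_sym : symmetric e) (e_irr : irreflexive e).
Local Notation I := (edge_ideal e k).
Local Notation L := (lcm_lattice I).
Implicit Types (x y z m : L) (A : {set 'I_n}).

Lemma mem_edges A : reflect (exists i j, e i j /\ A = [set i; j]) (A \in edges e).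
Proof.
apply: (iffP imsetP) => [[[i j]]|[i [j [eij ->]]]].
  by rewrite inE => eij ->; exists i, j.
by exists (i, j); rewrite ?inE.
Qed.

(** Brings the edge ideal into the form to which [mingen_least] and [monomial_idealP] apply. *)
Lemma edge_idealE :
  I = monomial_ideal (k := k) (fun u => exists i j, e i j /\ u = (U_(i) + U_(j))%MM).
Proof.
rewrite /edge_ideal /monomial_ideal; congr ideal_gen; apply: funext => p.
apply: propext; split=> [[i [j [eij ->]]]|[_ [i [j [eij ->]]] ->]].
  by exists (U_(i) + U_(j))%MM; [exists i, j | rewrite mpolyXD].
by exists i, j; rewrite mpolyXD.
Qed.

(** Monomials of the ideal have degree at least 2, so one that divides an edge monomial leaves a
    quotient of degree 0 and is equal to it. *)
Lemma mingen_edgeP (m : 'X_{1..n}) :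
  mingen I m <-> exists i j, e i j /\ m = (U_(i) + U_(j))%MM.
Proof.
split; first by rewrite edge_idealE => /mingen_least.
move=> [i [j [eij ->]]]; apply/asboolP; split.
  exists [:: (1, 'X_i * 'X_j)%R].
    by move=> u; rewrite inE => /eqP-> /=; exists i, j.
  by rewrite big_seq1 /= mul1r mpolyXD.
move=> m'; rewrite edge_idealE => /monomial_idealP[_ [a [b [_ ->]]] lem'] le'.
have := congr1 mdeg (submK le'); have := congr1 mdeg (submK lem').
rewrite !mdegD !mdeg1 => degm' degm.
have /eqP : mdeg (U_(i) + U_(j) - m')%MM = 0 by lia.
by rewrite mdeg_eq0 => /eqP d0; rewrite -[RHS](submK le') d0 add0m.
Qed.

Definition supp x : {set 'I_n} := [set i | lcm_mon x i != 0].

Lemma supp_edge i j l : e i j -> (U_(i) + U_(j))%MM l = (l \in [set i; j]).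
Proof.
move=> eij; rewrite mnmDE !mnm1E !inE ![l == _]eq_sym.
by case: eqP => [il|_]; case: eqP => [jl|_] //; rewrite il jl e_irr in eij.
Qed.

(** Edge monomials are squarefree since [e] has no loops, and lcms of squarefree monomials are
    squarefree. Hence the support determines the monomial. *)
Lemma lcm_monE x l : lcm_mon x l = (l \in supp x).
Proof.
rewrite inE; suff: lcm_mon x l <= 1 by case: (lcm_mon x l) => [|[]].
case: x => _ /= /[dup] /asboolP[s sI ->] _.
elim: s sI => [|u s IHs] /=; first by rewrite /mlcms big_nil mnm0E.
case/andP => /mingen_edgeP[i [j [eij ->]]] /IHs.
rewrite /mlcms big_cons mnm_mlcm supp_edge // geq_max => ->.
by case: (_ \in _).
Qed.

Lemma le_supp x y : (x <= y)%O = (supp x \subset supp y).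
Proof.
rewrite lcm_leE; apply/mnm_lepP/subsetP => [le i|sub i].
  by have := le i; rewrite !lcm_monE; case: (i \in supp x); case: (i \in supp y).
by have := sub i; rewrite !lcm_monE; case: (i \in supp x) => // ->.
Qed.

Lemma supp_inj : injective supp.
Proof.
by move=> x y xy; apply/le_anti; rewrite !le_supp xy subxx.
Qed.

Lemma lt_supp x y : (x < y)%O = (supp x \proper supp y).
Proof.
by rewrite properEneq -le_supp lt_def eq_sym (inj_eq supp_inj).
Qed.

Lemma supp_join x y : supp (Order.join x y) = supp x :|: supp y.
Proof. by apply/setP => i; rewrite !inE lcm_joinE mnm_mlcm; lia. Qed.

Lemma supp_bot : supp \bot%O = set0.
Proof. by apply/setP => i; rewrite !inE lcm_botE mnm0E. Qed.

Definition isolate_free A := {in A, forall i, exists2 j, j \in A & e i j}.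

(** A vertex in the support of an lcm lies on the edge of one of its generators, and the other end
    of that edge is in the support too. *)
Lemma supp_isolate_free x : isolate_free (supp x).
Proof.
move=> l; case: x => m /= /[dup] /asboolP[s sI ms] mP; rewrite inE /= => lm.
have [u us ul] : exists2 u, u \in s & u l != 0.
  apply: contrapT => nex; move/negP: lm; apply.
  rewrite ms -leqn0; suff: (mlcms s l <= 0)%N by [].
  rewrite /mlcms; elim: s nex {sI ms} => [|u s IHs] nex; first by rewrite big_nil mnm0E.
  rewrite big_cons mnm_mlcm geq_max; apply/andP; split.
    by rewrite leqn0; apply/eqP/eqP/negPn/negP => ul; apply: nex; exists u; rewrite ?inE ?eqxx.
  by apply: IHs => -[v vs vl]; apply: nex; exists v; rewrite // inE vs orbT.
have /mingen_edgeP[i [j [eij defu]]] := allP sI u us.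
have um : (u <= m)%MM by rewrite ms mem_mlcms.
have sub a : a \in [set i; j] -> a \in supp (LcmLattice mP).
  by move=> aij; have /mnm_lepP/(_ a) := um; rewrite defu supp_edge // aij inE /= lt0n.
have: l \in [set i; j] by move: ul; rewrite defu supp_edge //; case: (l \in _).
rewrite !inE => /orP[]/eqP->; [exists j | exists i];
  rewrite 1?[e j i]e_sym ?sub ?inE ?eqxx ?orbT //.
Qed.

(** The witness is the lcm of all generators dividing the squarefree monomial [mA]. Each vertex of
    [A] lies on an edge inside [A], so none is lost. *)
Lemma supp_surj A : isolate_free A -> exists x, supp x = A.
Proof.
pose mA := [multinom (i \in A : nat) | i < n] => Afree.
pose x : L := lcm_filter I (fun u => (u <= mA)%MM).
exists x; apply/setP => i; apply/idP/idP => [ix|iA].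
  have: (x <= mA)%MM by rewrite lcm_filter_le; apply/allP => u _; apply/implyP.
  by move/mnm_lepP/(_ i); rewrite lcm_monE ix mnmE; case: (i \in A).
have [j jA eij] := Afree i iA.
have: ((U_(i) + U_(j))%MM <= x)%MM.
  apply: le_lcm_filter; first by rewrite -mem_mingens; apply/mingen_edgeP; exists i, j.
  apply/mnm_lepP => l; rewrite supp_edge // mnmE !inE.
  by case: eqP => [->|_]; [rewrite iA | case: eqP => [->|//]; rewrite jA].
by move/mnm_lepP/(_ i); rewrite supp_edge // !inE eqxx lt0n.
Qed.

Lemma isolate_free_edge i j : e i j -> isolate_free [set i; j].
Proof.
move=> eij l; rewrite !inE => /orP[]/eqP->.
  by exists j; rewrite // !inE eqxx orbT.
by exists i; rewrite ?[e j i]e_sym // !inE eqxx.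
Qed.

Lemma isolate_freeU1 A i j :
  isolate_free A -> j \in A -> e i j -> isolate_free (i |: A).
Proof.
move=> Afree jA eij l; rewrite !inE => /orP[/eqP->|/Afree[a aA ela]].
  by exists j; rewrite // !inE jA orbT.
by exists a; rewrite // !inE aA orbT.
Qed.

Lemma supp_neq0 x : (supp x != set0) = (x != \bot%O).
Proof. by rewrite -supp_bot (inj_eq supp_inj). Qed.

Lemma supp_meet_sub x y : supp (Order.meet x y) \subset supp x :&: supp y.
Proof.
by rewrite subsetI -!le_supp leIl leIr.
Qed.

(** Under this hypothesis the intersection is itself the support of an element. In general the meet
    drops the isolated vertices of the intersection. *)
Lemma supp_meet x y :
  isolate_free (supp x :&: supp y) -> supp (Order.meet x y) = supp x :&: supp y.
Proof.
move=> /supp_surj[z defz]; apply/eqP; rewrite eqEsubset supp_meet_sub -defz -le_supp.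
by rewrite lexI !le_supp defz subsetIl subsetIr.
Qed.

(** * Atoms and covers *)

Lemma edge_below x : x != \bot%O ->
  exists i j y, [/\ e i j, supp y = [set i; j] & (y <= x)%O].
Proof.
rewrite -supp_neq0 => /set0Pn[i ix].
have [j jx eij] := supp_isolate_free ix.
have [y suppy] := supp_surj (isolate_free_edge eij).
by exists i, j, y; split; rewrite // le_supp suppy subUset !sub1set ix jx.
Qed.

Lemma card_edge i j : e i j -> #|[set i; j]| = 2.
Proof. by move=> eij; rewrite cards2; case: eqP eij => // ->; rewrite e_irr. Qed.

Lemma covers_edge y i j : e i j -> supp y = [set i; j] -> covers y \bot%O.
Proof.
move=> eij suppy; split=> [|z [z0 zy]].
  by rewrite lt_supp supp_bot suppy proper0; apply/set0Pn; exists i; rewrite !inE eqxx.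
(* A nonzero [z] contains an edge, hence has at least two vertices, too many for a proper subset of
   an edge. *)
have [|a [b [w [eab suppw wz]]]] := @edge_below z.
  by rewrite -lt0x.
move: wz zy; rewrite le_supp lt_supp => /subset_leq_card wz /proper_card.
by move: wz; rewrite suppy suppw !card_edge //; lia.
Qed.

Lemma covers_setU1 x y i : i \notin supp x -> supp y = i |: supp x -> covers y x.
Proof.
move=> ix suppy; split=> [|z [xz zy]].
  by rewrite lt_supp suppy properE subsetUr subUset sub1set (negPf ix).
move: xz zy; rewrite !lt_supp => /proper_card xz /proper_card.
by rewrite suppy cardsU1 ix; lia.
Qed.

(** * Supersolvability forces a dominating edge *)

Lemma exists_boundary_edge A : connected_graph e -> A != set0 -> A != setT ->
  exists i j, [/\ i \notin A, j \in A & e i j].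
Proof.
move=> e_conn /set0Pn[a aA]; rewrite -subTset => /subsetPn[b _ bA].
apply: contrapT => nex; move/negP: bA; apply.
(* Without a boundary edge, [A] is a union of connected components. *)
have Aclosed : closed e (mem A).
  apply: intro_closed => [|i j eij iA]; first exact: sym_connect_sym.
  apply: contrapT => /negP jA; apply: nex; exists j, i.
  by rewrite e_sym.
by have := closed_connect Aclosed (e_conn a b); rewrite aA => <-.
Qed.

(** The support grows to the whole vertex set by one adjacent vertex at a time, each step being a
    cover. The bottom is excluded because its covers add two vertices. *)
Lemma rank_corank (rk : L -> int) x : connected_graph e -> is_rank rk -> x != \bot%O ->
  (rk x + #|~: supp x|%:Z = rk \top%O)%R.
Proof.
move=> e_conn [_ _ rk_covers].
have [c] := ubnP #|~: supp x|; elim: c x => // c IHc x ltc x0.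
have [xT|xT] := eqVneq (supp x) setT.
  rewrite xT setCT cards0 addr0; congr rk; apply/eqP.
  by rewrite -le1x le_supp xT subsetT.
have [//||//|i [j [ix jx eij]]] := @exists_boundary_edge (supp x); first by rewrite supp_neq0.
have [y suppy] := supp_surj (isolate_freeU1 (@supp_isolate_free x) jx eij).
have yx := covers_setU1 ix suppy.
have cardx : #|~: supp x| = #|~: supp y|.+1.
  have := cardsC (supp x); have := cardsC (supp y).
  by rewrite suppy cardsU1 ix; lia.
rewrite -(IHc y) ?(rk_covers _ _ yx); [lia|lia|].
by rewrite -supp_neq0 suppy; apply/set0Pn; exists i; rewrite !inE eqxx.
Qed.

(** An edge inside the least nonzero element of [M] is comparable with all of [M], so maximality
    puts it in [M]. *)
Lemma edge_mem_maximal_chain (M : {set L}) :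
  edges e != set0 -> maximal_chain M ->
  exists i j y, [/\ e i j, supp y = [set i; j] & y \in M].
Proof.
move=> /set0Pn[_ /mem_edges[i0 [j0 [e0 _]]]] Mmax.
have [y0 suppy0] := supp_surj (isolate_free_edge e0).
have topM : (\top%O : L) \in M.
  by apply: maximal_chain_mem => // y _; rewrite ge_comparable ?lex1.
have top0 : (\top%O : L) != \bot%O.
  rewrite -supp_neq0; apply/set0Pn; exists i0.
  have: (y0 <= \top)%O by rewrite lex1.
  by rewrite le_supp suppy0 => /subsetP; apply; rewrite !inE eqxx.
(* [\top] only shows that candidates exist. In a chain, the smallest support belongs to the least
   element. *)
have [|m /andP[mM m0] mmin] :=
    @arg_minnP _ \top%O (fun m : L => (m \in M) && (m != \bot%O)) (fun m => #|supp m|).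
  by rewrite topM.
have [i [j [y [eij suppy ym]]]] := edge_below m0.
exists i, j, y; split=> //; apply: maximal_chain_mem => // z zM.
have [->|z0] := eqVneq z \bot%O; first by rewrite ge_comparable ?le0x.
have /maxsetP[/forall_inP/(_ m mM)/forall_inP/(_ z zM) + _] := Mmax.
case/orP=> [mz|zm]; first by rewrite le_comparable // (le_trans ym).
suff -> : z = m by rewrite le_comparable.
apply: supp_inj; apply/eqP; rewrite eqEcard -le_supp zm mmin //.
by rewrite zM.
Qed.

Lemma supersolvable_adjacent :
  connected_graph e -> edges e != set0 -> supersolvable L ->
  exists2 a, a \in edges e & forall b, b \in edges e -> b != a -> adjacent a b.
Proof.
move=> e_conn e_nontriv [rk [rkP [M Mmax Mmod]]].
have [i [j [y [eij suppy yM]]]] := edge_mem_maximal_chain e_nontriv Mmax.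
exists [set i; j]; first by apply/mem_edges; exists i, j.
move=> _ /mem_edges[a [b [eab ->]]] neq; rewrite /adjacent eq_sym neq /=.
apply/negP => /eqP disj.
have [z suppz] := supp_surj (isolate_free_edge eab).
have rk0 : rk \bot%O = 0%R by case: rkP.
have rky : rk y = 1%R by case: rkP => _ _ /(_ _ _ (covers_edge eij suppy)) ->; rewrite rk0.
have rkz : rk z = 1%R by case: rkP => _ _ /(_ _ _ (covers_edge eab suppz)) ->; rewrite rk0.
have meet0 : Order.meet z y = \bot%O.
  apply/eqP; rewrite -[_ == _]negbK -supp_neq0 negbK -subset0 -disj -suppy -suppz setIC.
  exact: supp_meet_sub.
have y0 : y != \bot%O by rewrite -supp_neq0 -card_gt0 suppy card_edge.
have join0 : Order.join z y != \bot%O.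
  rewrite -supp_neq0 -card_gt0 supp_join suppy suppz.
  by rewrite (leq_trans _ (subset_leq_card (subsetUr _ _))) ?card_edge.
have := Mmod y z yM; rewrite meet0 rk0 rky rkz add0r => rkjoin.
(* The join has four vertices and rank 2, so the corank formula would read
   [1 + (n - 2) = 2 + (n - 4)]. *)
have := rank_corank e_conn rkP y0; rewrite -(rank_corank e_conn rkP join0) rky.
have := cardsC (supp y); have := cardsC (supp (Order.join z y)).
have := cardsUI [set a; b] [set i; j]; rewrite [_ :&: _]setIC disj cards0 !card_edge //.
rewrite supp_join suppy suppz !card_edge //.
rewrite -rkjoin /reverse_coercion; lia.
Qed.

(** * A dominating edge gives supersolvability *)

Section DominatingEdge.
Variables a b : 'I_n.
Hypotheses (eab : e a b).
Hypothesis dom : forall i j, e i j -> (i \in [set a; b]) || (j \in [set a; b]).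

(** Lets later arguments treat the two ends of the edge symmetrically. *)
Lemma other_end d : d \in [set a; b] -> exists2 d', e d d' & [set a; b] = [set d; d'].
Proof.
by rewrite !inE => /orP[]/eqP->; [exists b | exists a; rewrite 1?e_sym // setUC].
Qed.

Lemma supp_meets_dom x : x != \bot%O -> exists2 d, d \in [set a; b] & d \in supp x.
Proof.
rewrite -supp_neq0 => /set0Pn[i ix]; have [j jx eij] := supp_isolate_free ix.
by have /orP[] := dom eij; [exists i | exists j].
Qed.

(** If the end [d'] is new in [y], it is joined to [d] in [x]. Otherwise a new vertex [v] lies off
    the edge [ab], so its neighbour [u] in [y] is an end of [ab], hence already in [x]. *)
Lemma dom_boundary_edge x y : x != \bot%O -> (x < y)%O ->
  exists i j, [/\ i \in supp y, i \notin supp x, j \in supp x & e i j].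
Proof.
move=> x0; rewrite lt_supp => /properP[_ [v vy vx]].
have [u uy evu] := supp_isolate_free vy.
have [d dab dx] := supp_meets_dom x0; have [d' edd' defab] := other_end dab.
have [/andP[d'y d'x]|nd'] := boolP ((d' \in supp y) && (d' \notin supp x)).
  by exists d', d; rewrite e_sym.
have domx w : w \in supp y -> w \in [set a; b] -> w \in supp x.
  move=> wy; rewrite defab in_set2 => /orP[]/eqP defw; subst w => //.
  by move: nd'; rewrite wy /= negbK.
exists v, u; split=> //; have /orP[/(domx _ vy) vx'|] := dom evu; last exact: domx.
by rewrite vx' in vx.
Qed.

Definition dom_rank x : int := #|supp x|.-1%:Z.

Lemma dom_rankP : is_rank dom_rank.
Proof.
split=> [x y||x y [xy nxy]].
- by rewrite le_supp /dom_rank => /subset_leq_card; lia.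
- by rewrite /dom_rank supp_bot cards0.
(* A cover of the bottom is a single edge, of rank [2.-1]. Any other cover adds exactly one vertex,
   since a boundary vertex yields an element [z] with [x < z <= y]. *)
have [x0|x0] := eqVneq x \bot%O; rewrite /dom_rank.
  have y0 : y != \bot%O by rewrite x0 lt0x in xy.
  have [i [j [z [eij suppz]]]] := edge_below y0.
  rewrite le_eqVlt => /orP[/eqP<-|zy]; first by rewrite suppz x0 supp_bot card_edge ?cards0.
  by case: (nxy z); rewrite x0 lt0x -supp_neq0 -card_gt0 suppz card_edge.
have [i [j [iy ix jx eij]]] := dom_boundary_edge x0 xy.
have [z suppz] := supp_surj (isolate_freeU1 (@supp_isolate_free x) jx eij).
have zy : (z <= y)%O by rewrite le_supp suppz subUset sub1set iy -le_supp ltW.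
have [xz _] := covers_setU1 ix suppz.
have -> : y = z.
  by move: zy; rewrite le_eqVlt => /orP[/eqP//|zy]; case: (nxy z).
by rewrite suppz cardsU1 ix; move: x0; rewrite -supp_neq0 -card_gt0; lia.
Qed.

(* If [supp x :&: supp m] has an isolated vertex i, then i is an end of ab
   whose other end is not in x, so x is a star centred at i and the
   intersection is {i}. *)
Lemma dom_rank_meet m x : [set a; b] \subset supp m ->
  dom_rank (Order.meet x m) = #|supp x :&: supp m|.-1%:Z%R.
Proof.
move=> abm; rewrite /dom_rank.
have [Cfree|Cnfree] := pselect (isolate_free (supp x :&: supp m)).
  by rewrite supp_meet.
suff C1 : #|supp x :&: supp m| <= 1.
  by have := subset_leq_card (supp_meet_sub x m); lia.
have [i iC iisol] : exists2 i, i \in supp x :&: supp m &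
    forall j, j \in supp x :&: supp m -> ~~ e i j.
  apply: contrapT => nex; apply: Cnfree => i iC; apply: contrapT => ni.
  by apply: nex; exists i => // j jC; apply/negP => eij; apply: ni; exists j.
have [ix im] := setIP iC; have [j jx eij] := supp_isolate_free ix.
have iab : i \in [set a; b].
  have /orP[//|jab] := dom eij.
  by have := iisol j; rewrite in_setI jx (subsetP abm) // eij => /(_ isT).
have [d eid defab] := other_end iab.
have dx : d \notin supp x.
  apply/negP => dx; have := iisol d.
  by rewrite in_setI dx (subsetP abm) ?defab ?in_set2 ?eqxx ?orbT // eid => /(_ isT).
rewrite -(cards1 i); apply: subset_leq_card; apply/subsetP => l lC.
have [lx _] := setIP lC; have [l' l'x ell'] := supp_isolate_free lx.
have ends w : w \in supp x -> w \in [set a; b] -> w = i.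
  by move=> wx; rewrite defab in_set2 => /orP[]/eqP // defw; rewrite -defw wx in dx.
rewrite inE; have /orP[/(ends _ lx)->//|/(ends _ l'x) l'i] := dom ell'.
by have := iisol l lC; rewrite e_sym -l'i ell'.
Qed.

Lemma dom_supersolvable : supersolvable L.
Proof.
exists dom_rank; split; first exact: dom_rankP.
have [y suppy] := supp_surj (isolate_free_edge eab).
(* Since [y] is an atom of the chain, every nonzero member of [M] lies above it and so contains [a]
   and [b]. *)
have [|M Mmax] := @maxset_exists _ is_chain [set \bot%O; y].
  apply/forall_inP => u; rewrite !inE => uB; apply/forall_inP => v; rewrite !inE => vB.
  case/orP: uB => /eqP->; first by rewrite le_comparable ?le0x.
  by case/orP: vB => /eqP->; rewrite ?comparablexx // ge_comparable ?le0x.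
rewrite subUset !sub1set => /andP[_ yM]; exists M => // m x mM.
have [->|m0] := eqVneq m \bot%O; first by rewrite meetx0 joinx0 addrC.
have [->|x0] := eqVneq x \bot%O; first by rewrite meet0x join0x.
have abm : [set a; b] \subset supp m.
  rewrite -suppy -le_supp.
  have /maxsetP[/forall_inP/(_ y yM)/forall_inP/(_ m mM) + _] := Mmax.
  case/orP=> //; rewrite le_eqVlt => /orP[/eqP->//|my].
  by case: (covers_edge eab suppy) => _ /(_ m) []; rewrite lt0x.
rewrite dom_rank_meet // /dom_rank supp_join.
have [d dab dx] := supp_meets_dom x0.
(* With a nonempty intersection no predecessor truncates, and modularity becomes inclusion-exclusion
   for cardinalities. *)
have: 0 < #|supp x :&: supp m|.
  by rewrite card_gt0; apply/set0Pn; exists d; rewrite in_setI dx (subsetP abm).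
have := cardsUI (supp x) (supp m); have := subset_leq_card (subsetIl (supp x) (supp m)).
have := subset_leq_card (subsetIr (supp x) (supp m)); lia.
Qed.

End DominatingEdge.
End Support.

Theorem theorem6p5 (k : fieldType) (n : nat) (e : rel 'I_n)
  (e_sym : symmetric e) (e_irr : irreflexive e)
  (e_conn : connected_graph e) (e_nontrivial : edges e != set0) :
  supersolvable (lcm_lattice (edge_ideal e k)) <->
  exists2 a, a \in edges e & forall b, b \in edges e -> b != a -> adjacent a b.
Proof.
split; first exact: supersolvable_adjacent.
case=> _ /mem_edges[a [b [eab ->]]] adj.
apply: (dom_supersolvable e_sym e_irr eab) => i j eij.
have [<-|neq] := eqVneq [set i; j] [set a; b]; first by rewrite !inE eqxx.
have /adj/(_ neq)/andP[_ /set0Pn[d /setIP[dab]]] : [set i; j] \in edges e.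
  by apply/mem_edges; exists i, j.
by rewrite inE => /orP[]/set1P defd; rewrite -defd dab ?orbT.
Qed.
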